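(* Let $0 \le a, b \le 1$ be real numbers and let $v_1, v_2, g$ be positive integers. If $g \geq 6$, $\gcd(v_1,g) = 1$, $v_2 \not\equiv 0 \pmod g$, and $v_1 \not\equiv \pm v_2 \pmod g$ (i.e. $v_1 \not\equiv v_2$ and $v_1 \not\equiv -v_2$ modulo $g$), then there exists an integer $h$ with $0 \leq h < g$ such that $$\min\left(\left\|\frac{h}{g}v_1 + a\right\|,\ \left\|\frac{h}{g}v_2 + b\right\|\right) \geq \frac14.$$
   Context: For real $x$, $\|x\|$ denotes the distance from $x$ to the nearest integer. *)

(* Defs.v *)
From HB Require Import structures.
From mathcomp Require Import all_boot all_order all_algebra.
From mathcomp Require Import boolp classical_sets reals.

Set Implicit Arguments.
Unset Strict Implicit.
Unset Printing Implicit Defensive.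

Import Order.TTheory GRing.Theory Num.Theory.

Local Open Scope classical_set_scope.
Local Open Scope ring_scope.

(* ||x||: the infimum is attained, see distZ_attained. *)
Definition distZ (R : realType) (x : R) : R :=
  inf [set `|x - n%:~R| | n in [set: int]].

Lemma distZ_le (R : realType) (x : R) (n : int) : distZ x <= `|x - n%:~R|.
Proof.
apply: ge_inf; last by exists n.
by exists 0 => _ [m _ <-]; exact: normr_ge0.
Qed.

Lemma distZ_attained (R : realType) (x : R) :
  exists n : int, distZ x = `|x - n%:~R|.
Proof.
suff [n Hn] : exists n : int, forall m : int, `|x - n%:~R| <= `|x - m%:~R|.
  exists n; apply/le_anti; rewrite distZ_le /=.
  apply: lb_le_inf; first by exists `|x - n%:~R|, n.
  by move=> _ [m _ <-].
set f := Num.floor x.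
have fx : f%:~R <= x := floor_le x.
have xf1 : x < (f + 1)%:~R := floorD1_gt x.
have Hmin (m : int) :
    `|x - f%:~R| <= `|x - m%:~R| \/ `|x - (f + 1)%:~R| <= `|x - m%:~R|.
  case: (lerP m f) => [mf|fm]; [left|right].
    have mfR : m%:~R <= f%:~R :> R by rewrite ler_int.
    by rewrite !ger0_norm ?subr_ge0 ?(le_trans mfR) // lerB.
  have fmR : (f + 1)%:~R <= m%:~R :> R by rewrite ler_int lezD1.
  rewrite !ler0_norm ?subr_le0 ?(ltW xf1) ?(le_trans (ltW xf1)) //.
  by rewrite lerN2 lerB.
case: (lerP `|x - f%:~R| `|x - (f + 1)%:~R|) => [le01|/ltW le10].
  by exists f => m; case: (Hmin m) => // /(le_trans le01).
by exists (f + 1) => m; case: (Hmin m) => // /(le_trans le10).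
Qed.

(* Main.v *)
Require Import Defs.
From HB Require Import structures.
From mathcomp Require Import all_boot all_order all_algebra.
From mathcomp Require Import boolp classical_sets reals.
From mathcomp Require Import zify ring lra.

(** Why the theorem is true.  Multiplying [h] by an inverse of [v1] modulo [g]
    reduces to [v1 = 1] and [v2 = k], where the hypotheses say exactly that
    [k] is none of [0, 1, -1] modulo [g]; replacing [(k, b)] by [(- k, - b)] if
    need be, one may take [2 <= k <= g / 2] ([exists_far_pair],
    [exists_far_pair_sym]).

    On the circle [R / Z], the points at distance at least [1/4] from [0] form
    the closed half-circle [[1/4, 3/4]].  The points [h / g + a] run around the
    circle in steps of [1 / g], so some [g / 2] (rounded down) consecutive
    values of [h] put them in this half-circle.  For the same values of [h], the
    points [h * k / g + b] advance in steps of [k / g <= 1/2], which is too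
    short to jump over a closed half-circle, while their total displacement is
    at least [(g / 2 - 1) * 2 / g >= 1/2] because [g >= 6], which is enough to
    leave the complementary open half-circle.  Hence one of these points is far
    from [0] as well ([walk_meets_far]). *)

Set Implicit Arguments.
Unset Strict Implicit.
Unset Printing Implicit Defensive.

Import Order.TTheory GRing.Theory Num.Theory.

Local Open Scope ring_scope.

Lemma distZ_addz (R : realType) (x : R) (m : int) :
  distZ (x + m%:~R) = distZ x.
Proof.
have le_shift (y : R) (p : int) : distZ (y + p%:~R) <= distZ y.
  have [n ->] := distZ_attained y.
  apply: le_trans (distZ_le _ (n + p)) _.
  by rewrite intrD opprD addrACA subrr addr0.
apply/le_anti; rewrite le_shift /=.
by have := le_shift (x + m%:~R) (- m); rewrite intrN addrK.
Qed.

Lemma distZN (R : realType) (x : R) : distZ (- x) = distZ x.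
Proof.
have leN (y : R) : distZ (- y) <= distZ y.
  have [n ->] := distZ_attained y.
  apply: le_trans (distZ_le _ (- n)) _.
  by rewrite intrN -opprD normrN.
by apply/le_anti; rewrite leN /= -{1}[x]opprK leN.
Qed.

Lemma distZ_ge_quarter (R : realType) (x : R) (m : int) :
  m%:~R + 1 / 4 <= x <= m%:~R + 3 / 4 -> 1 / 4 <= distZ x.
Proof.
move=> /andP[lex xle]; have [n ->] := distZ_attained x.
rewrite ler_normr; case: (lerP n m) => [nm|].
  have nmR : n%:~R <= m%:~R :> R by rewrite ler_int.
  by apply/orP; left; lra.
rewrite -lezD1 => mn.
have mnR : m%:~R + 1 <= n%:~R :> R by rewrite -(intrD _ m 1) ler_int.
by apply/orP; right; lra.
Qed.

(** The first point of the walk beyond the left end [m + 1/4] of the next far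
    half-circle cannot also be beyond its right end [m + 3/4], as the step is at
    most [1/2]; and the [n]-th point is beyond the left end. *)
Lemma walk_meets_far (R : realType) (y d : R) (n : nat) :
    d <= 1 / 2 -> 1 / 2 <= n%:R * d ->
  exists2 i : nat, (i <= n)%N & 1 / 4 <= distZ (y + i%:R * d).
Proof.
move=> d_le n_ge.
(* With this choice of [m], the start lies in the interval (m - 1/4, m + 3/4]. *)
pose m := Num.ceil (y - 3 / 4).
have y_le : y - 3 / 4 <= m%:~R := ceil_ge _.
have y_gt : (m - 1)%:~R < y - 3 / 4 := ceilB1_lt _.
rewrite intrB mulr1z in y_gt.
pose P i := m%:~R + 1 / 4 <= y + i%:R * d.
have Pn : P n by rewrite /P; lra.
have exP : exists i, P i by exists n.
case: (ex_minnP exP) => i Pi min_i; exists i; first exact: min_i.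
apply: (@distZ_ge_quarter _ _ m); apply/andP; split=> //.
case: i Pi min_i => [|i] Pi min_i; first by rewrite mul0r; lra.
have : ~~ P i by apply/negP => /min_i; rewrite ltnn.
by rewrite /P -ltNge -[i.+1%:R]natr1; lra.
Qed.

(** The bounds on [k] balance each other: steps of at most half a turn cannot
    miss the far half-circle, and steps of at least [2 / g] complete the half
    turn that is needed within the available run of consecutive [j]. *)
Lemma exists_far_pair (R : realType) (a b : R) (g : nat) (k : int) :
    (6 <= g)%N -> 2 <= k -> k * 2 <= g%:Z ->
  exists j : int, 1 / 4 <= distZ (j%:~R / g%:R + a) /\
                  1 / 4 <= distZ (j%:~R / g%:R * k%:~R + b).
Proof.
move=> g_ge k_ge k_le.
have gR_gt0 : 0 < g%:R :> R by rewrite ltr0n; lia.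
have kR_le : k%:~R * 2 <= g%:R :> R.
  have : (k * 2)%:~R <= g%:Z%:~R :> R by rewrite ler_int.
  by rewrite intrM.
(* A run of [g / 2] consecutive [j] consists of [n] steps. *)
pose n := (g./2).-1.
have nR_le : (n%:R + 1) * 2 <= g%:R :> R.
  by rewrite natr1 -natrM ler_nat /n; lia.
have g_le_nk : g%:R <= n%:R * k%:~R * 2 :> R.
  have : g%:Z%:~R <= (n%:Z * k * 2)%:~R :> R by rewrite ler_int /n; nia.
  by rewrite !intrM.
(* [j] is the first integer for which [j / g + a] reaches [1/4]. *)
pose j := Num.ceil (g%:R * (1 / 4 - a)).
have j_ge : g%:R * (1 / 4 - a) <= j%:~R := ceil_ge _.
have j_lt : (j - 1)%:~R < g%:R * (1 / 4 - a) := ceilB1_lt _.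
rewrite intrB mulr1z in j_lt.
have [| |i i_le far_i] :=
    @walk_meets_far R (j%:~R / g%:R * k%:~R + b) (k%:~R / g%:R) n.
- by rewrite ler_pdivrMr //; lra.
- by rewrite mulrA ler_pdivlMr //; lra.
exists (j + i%:Z); split; last first.
  suff -> : (j + i%:Z)%:~R / g%:R * k%:~R + b
      = j%:~R / g%:R * k%:~R + b + i%:R * (k%:~R / g%:R) :> R by [].
  by rewrite intrD -pmulrn; ring.
have iR_ge0 : 0 <= i%:R :> R by rewrite ler0n.
have iR_le : i%:R <= n%:R :> R by rewrite ler_nat.
apply: (@distZ_ge_quarter _ _ 0); rewrite intrD -pmulrn.
have ge_quarter : 1 / 4 - a <= (j%:~R + i%:R) / g%:R.
  by rewrite ler_pdivlMr //; lra.
have le_three_quarters : (j%:~R + i%:R) / g%:R <= 3 / 4 - a.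
  by rewrite ler_pdivrMr //; lra.
by rewrite mulr0z; apply/andP; split; lra.
Qed.

(** Reflecting the second circle turns the multiplier [k] into [g - k]. *)
Lemma exists_far_pair_sym (R : realType) (a b : R) (g : nat) (k : int) :
    (6 <= g)%N -> 2 <= k -> k + 2 <= g%:Z ->
  exists j : int, 1 / 4 <= distZ (j%:~R / g%:R + a) /\
                  1 / 4 <= distZ (j%:~R / g%:R * k%:~R + b).
Proof.
move=> g_ge k_ge k_le; case: (lerP (k * 2) g%:Z) => [|k_gt].
  exact: exists_far_pair.
have gR_neq0 : g%:R != 0 :> R by rewrite pnatr_eq0; lia.
have [||j [far1 far2]] := @exists_far_pair R a (- b) g (g%:Z - k) g_ge.
- by lia.
- by lia.
exists j; split=> //; rewrite -distZN -(distZ_addz _ j).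
suff -> : - (j%:~R / g%:R * k%:~R + b) + j%:~R
    = j%:~R / g%:R * (g%:Z - k)%:~R - b :> R by [].
by rewrite intrB -pmulrn; field.
Qed.

Lemma distZ_modz (R : realType) (a : R) (g v : nat) (h : int) : (0 < g)%N ->
  distZ ((h %% g%:Z)%Z%:~R / g%:R * v%:R + a) = distZ (h%:~R / g%:R * v%:R + a).
Proof.
move=> g_gt0; have gR_neq0 : g%:R != 0 :> R by rewrite pnatr_eq0 -lt0n.
rewrite -(distZ_addz _ ((h %/ g%:Z)%Z * v%:Z)); congr distZ.
have -> : h%:~R = (h %/ g%:Z)%Z%:~R * g%:R + (h %% g%:Z)%Z%:~R :> R.
  by rewrite {1}(divz_eq h g%:Z) intrD intrM.
by rewrite intrM -pmulrn; field.
Qed.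

(** The multiplier to which [v2] is reduced when [v1] is normalised to [1]:
    [u] inverts [v1], and [k] is [v2 / v1] modulo [g]. *)
Lemma exists_modular_ratio (v1 v2 g : nat) : (0 < g)%N -> gcdn v1 g = 1%N ->
  exists u k : int, [/\ (u * v1%:Z = 1 %[mod g%:Z])%Z,
    (u * v2%:Z = k %[mod g%:Z])%Z, (v2%:Z = v1%:Z * k %[mod g%:Z])%Z
    & 0 <= k < g%:Z].
Proof.
move=> g_gt0 co; have [u [w uw]] := Bezoutz v1%:Z g%:Z.
rewrite /gcdz !absz_nat co in uw.
exists u, (u * v2%:Z %% g%:Z)%Z; split.
- by apply/eqP; rewrite eqz_mod_dvd; apply/dvdzP; exists (- w); lia.
- by rewrite modz_mod.
- rewrite modzMmr; apply/eqP; rewrite eqz_mod_dvd.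
  apply/dvdzP; exists (w * v2%:Z).
  have : (u * v1%:Z + w * g%:Z) * v2%:Z = v2%:Z by rewrite uw mul1r.
  by move=> {1}<-; ring.
- by apply/andP; split; [apply: modz_ge0; lia | apply: ltz_pmod].
Qed.

Theorem lemma5p1 (R : realType) (a b : R) (v1 v2 g : nat)
    (ha : 0 <= a <= 1) (hb : 0 <= b <= 1)
    (hv1 : (0 < v1)%N) (hv2 : (0 < v2)%N) (hg0 : (0 < g)%N)
    (hg : (6 <= g)%N)
    (hv1g : gcdn v1 g = 1%N)
    (hv2g : (v2%:Z != 0 %[mod g%:Z])%Z)
    (hv12 : (v1%:Z != v2%:Z %[mod g%:Z])%Z)
    (hv12N : (v1%:Z != - v2%:Z %[mod g%:Z])%Z) :
  exists h : int, 0 <= h < g%:Z /\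
    1 / 4 <= Num.min (distZ (h%:~R / g%:R * v1%:R + a))
                     (distZ (h%:~R / g%:R * v2%:R + b)).
Proof.
have [u [k [uv1 uv2 v2k /andP[k_ge0 k_lt]]]] := exists_modular_ratio v2 hg0 hv1g.
have k_neq0 : k != 0.
  by apply: contraNneq hv2g => k0; rewrite v2k k0 mulr0.
have k_neq1 : k != 1.
  by apply: contraNneq hv12 => k1; rewrite v2k k1 mulr1.
have k_neqN1 : k != g%:Z - 1.
  apply: contraNneq hv12N => kN1; rewrite -modzNm v2k kN1 modzNm.
  by rewrite eqz_mod_dvd; apply/dvdzP; exists v1%:Z; ring.
have [||j [far1 far2]] := @exists_far_pair_sym R a b g k hg; [lia|lia|].
have gR_neq0 : g%:R != 0 :> R by rewrite pnatr_eq0 -lt0n.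
(* Congruent multipliers give the same points on the circle. *)
have far_mult (v : nat) (r : int) (c : R) : (u * v%:Z = r %[mod g%:Z])%Z ->
    distZ ((j * u)%:~R / g%:R * v%:R + c) = distZ (j%:~R / g%:R * r%:~R + c).
  move=> /eqP; rewrite eqz_mod_dvd => /dvdzP[q uvr].
  rewrite -[RHS](distZ_addz _ (j * q)); congr distZ.
  have {}uvr : u%:~R * v%:R = r%:~R + q%:~R * g%:R :> R.
    have : (u * v%:Z)%:~R = (r + q * g%:Z)%:~R :> R.
      by rewrite -uvr addrC subrK.
    by rewrite intrD !intrM.
  have -> : (j * u)%:~R / g%:R * v%:R = j%:~R / g%:R * (u%:~R * v%:R) :> R.
    by rewrite intrM; ring.
  by rewrite uvr intrM; field.
exists ((j * u) %% g%:Z)%Z; split.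
  by apply/andP; split; [apply: modz_ge0; rewrite eqz_nat -lt0n | apply: ltz_pmod].
rewrite le_min !distZ_modz // (far_mult _ _ _ uv1) (far_mult _ _ _ uv2).
by rewrite mulr1 far1 far2.
Qed.
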